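(* Let $X\subset\mathbb{P}^n$ be a closed subscheme which is scheme theoretically defined by quadrics $F_0,\ldots,F_s$ satisfying condition $(K_2)$. Then the rational map $\varphi:\mathbb{P}^n\dashrightarrow\mathbb{P}^s$, $x\mapsto[F_0(x):\cdots:F_s(x)]$, is an embedding off $\mathrm{Sec}\,X$.
   Context: We work over $\mathbb{C}$. Condition $(K_d)$: forms $F_0,\ldots,F_s$ of degree $d$ on $\mathbb{P}^n$ satisfy $(K_d)$ if the trivial (Koszul) syzygies $F_j e_i-F_i e_j$ among the $F_i$ are generated by linear syzygies, i.e. lie in the submodule of the syzygy module generated by the syzygies $(a_0,\ldots,a_s)$, $\sum a_iF_i=0$, with all $a_i$ linear forms. $\mathrm{Sec}\,X$ is the secant variety, i.e. the variety of lines meeting $X$ in a scheme of length at least $2$ (secant and tangent lines). ''Embedding off $W$'' means that the restriction of the map to the complement of $W$ is an embedding. *)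

(* Defs.v *)
From HB Require Import structures.
From mathcomp Require Import all_boot all_order all_algebra.
From mathcomp Require Export all_boot all_algebra reals complex.
From mathcomp.multinomials Require Export mpoly.

Set Implicit Arguments.
Unset Strict Implicit.
Unset Printing Implicit Defensive.

Import GRing.Theory.
Local Open Scope ring_scope.

(* A point of P^n is given by a nonzero row vector x of homogeneous           *)
(* coordinates.  Two nonzero vectors are the same point when they span the    *)
(* same line, i.e. (x == y)%MS.  A line of P^n is the row space of a          *)
(* 2 x (n+1) matrix A of rank 2, and x lies on it when (x <= A)%MS.           *)
(* A set of points is a predicate on row vectors, of which only the values at *)
(* nonzero vectors matter.                                                    *)

Section Subschemes.
Variables (K : fieldType) (n : nat).
Implicit Types (I J : {mpoly K[n.+1]} -> Prop) (p q : {mpoly K[n.+1]}).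

Definition is_ideal I :=
  [/\ I 0, (forall p q, I p -> I q -> I (p + q))
    & (forall p q, I q -> I (p * q))].

Definition is_homogeneous I := forall p d, I p -> I (pihomog mdeg d p).

(* Saturation with respect to the irrelevant ideal ('X_0, ..., 'X_n).         *)
Definition saturation I p := exists N, forall i, I ('X_i ^+ N * p).

(* Closed subschemes of P^n correspond bijectively to saturated homogeneous   *)
(* ideals.                                                                    *)
Record closed_subscheme := ClosedSubscheme {
  ideal_of :> {mpoly K[n.+1]} -> Prop;
  ideal_ofP : is_ideal ideal_of;
  ideal_of_homogeneous : is_homogeneous ideal_of;
  ideal_of_saturated : forall p, saturation ideal_of p -> ideal_of p
}.

Definition generated_ideal s (F : 'I_s -> {mpoly K[n.+1]}) p :=
  exists a : 'I_s -> {mpoly K[n.+1]}, p = \sum_i a i * F i.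

(* The ideal sheaf of X is the one generated by F, that is, (F) and the ideal *)
(* of X agree up to saturation.                                               *)
Definition scheme_defined_by (X : closed_subscheme) s
    (F : 'I_s -> {mpoly K[n.+1]}) :=
  forall p, X p <-> saturation (generated_ideal F) p.

Definition line_ideal (A : 'M[K]_(2, n.+1)) p :=
  forall x : 'rV[K]_n.+1, (x <= A)%MS -> p.@[x 0] = 0.

(* The ideal of a scheme-theoretic intersection (possibly unsaturated).       *)
Definition sum_ideal I J p := exists q r, [/\ I q, J r & p = q + r].

(* The subscheme defined by the homogeneous ideal I has length at least k:    *)
(* the Hilbert function d |-> dim (S/I)_d is at least k for all large d.  On  *)
(* a finite subscheme this function is eventually the length; a subscheme of  *)
(* positive dimension (e.g. a line contained in X) has length at least every  *)
(* k.                                                                         *)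
Definition length_at_least k I :=
  exists N, forall d, (N <= d)%N ->
    exists p : 'I_k -> {mpoly K[n.+1]},
      (forall i, p i \is d.-homog) /\
      (forall c : 'I_k -> K, I (\sum_i c i *: p i) -> forall i, c i = 0).

Definition Sec (X : closed_subscheme) (x : 'rV[K]_n.+1) :=
  exists A : 'M[K]_(2, n.+1),
    [/\ \rank A = 2, (x <= A)%MS
      & length_at_least 2 (sum_ideal X (line_ideal A))].

End Subschemes.

Section Koszul.
Variables (K : fieldType) (n s : nat) (F : 'I_s -> {mpoly K[n.+1]}).

Definition syzygy (a : 'rV[{mpoly K[n.+1]}]_s) := \sum_i a 0 i * F i = 0.

Definition linear_syzygy (a : 'rV[{mpoly K[n.+1]}]_s) :=
  syzygy a /\ forall i, a 0 i \is 1.-homog.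

Definition koszul_syzygy (i j : 'I_s) : 'rV[{mpoly K[n.+1]}]_s :=
  F j *: delta_mx 0 i - F i *: delta_mx 0 j.

Definition in_linear_syzygy_module (a : 'rV[{mpoly K[n.+1]}]_s) :=
  exists (m : nat) (b : 'I_m -> 'rV[{mpoly K[n.+1]}]_s)
         (c : 'I_m -> {mpoly K[n.+1]}),
    (forall k, linear_syzygy (b k)) /\ a = \sum_k c k *: b k.

Definition condition_K (d : nat) :=
  (forall i, F i \is d.-homog) /\
  (forall i j, in_linear_syzygy_module (koszul_syzygy i j)).

End Koszul.

Section QuasiProjective.
Variable K : fieldType.

Definition zariski_closed n (Z : 'rV[K]_n.+1 -> Prop) :=
  exists S : {mpoly K[n.+1]} -> Prop,
    (forall p, S p -> exists d, p \is d.-homog) /\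
    (forall x, x != 0 -> (Z x <-> forall p, S p -> p.@[x 0] = 0)).

Definition locally_closed n (U : 'rV[K]_n.+1 -> Prop) :=
  exists Z1 Z2 : 'rV[K]_n.+1 -> Prop,
    [/\ zariski_closed Z1, zariski_closed Z2
      & forall x, x != 0 -> (U x <-> Z1 x /\ ~ Z2 x)].

Definition eval_forms n m (G : 'I_m.+1 -> {mpoly K[n.+1]}) (x : 'rV[K]_n.+1) :
    'rV[K]_m.+1 :=
  \row_i (G i).@[x 0].

(* f restricts to a morphism from the quasi-projective variety U to P^m:      *)
(* Zariski locally on U it is given by forms of the same degree without       *)
(* common zeros.                                                              *)
Definition regular_on n m (U : 'rV[K]_n.+1 -> Prop)
    (f : 'rV[K]_n.+1 -> 'rV[K]_m.+1) :=
  forall x, x != 0 -> U x ->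
    exists (e d : nat) (G : 'I_m.+1 -> {mpoly K[n.+1]}) (h : {mpoly K[n.+1]}),
      [/\ forall i, G i \is e.-homog, h \is d.-homog, h.@[x 0] != 0
        & forall x', x' != 0 -> U x' -> h.@[x' 0] != 0 ->
            eval_forms G x' != 0 /\ (eval_forms G x' == f x')%MS].

Definition image_pts n m (U : 'rV[K]_n.+1 -> Prop)
    (f : 'rV[K]_n.+1 -> 'rV[K]_m.+1) (y : 'rV[K]_m.+1) :=
  exists x, [/\ x != 0, U x & (y == f x)%MS].

(* An embedding of the quasi-projective variety U in P^m is an isomorphism of *)
(* U onto a locally closed subvariety of P^m.  As U is reduced, this is the   *)
(* same as an immersion of schemes.                                           *)
Definition embedding n m (U : 'rV[K]_n.+1 -> Prop)
    (f : 'rV[K]_n.+1 -> 'rV[K]_m.+1) :=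
  [/\ locally_closed U, regular_on U f, locally_closed (image_pts U f)
    & exists g : 'rV[K]_m.+1 -> 'rV[K]_n.+1,
        regular_on (image_pts U f) g /\
        (forall x, x != 0 -> U x -> (g (f x) == x)%MS)].

(* The rational map x |-> [F_0(x) : ... : F_m(x)] is regarded as defined at   *)
(* the points x where the F_i do not all vanish; its restriction to the       *)
(* complement of W is its restriction to the points outside W where it is     *)
(* defined.                                                                   *)
Definition embedding_off n m (W : 'rV[K]_n.+1 -> Prop)
    (F : 'I_m.+1 -> {mpoly K[n.+1]}) :=
  embedding (fun x => eval_forms F x != 0 /\ ~ W x) (eval_forms F).

End QuasiProjective.

(* Main.v *)
Require Import Defs.
From HB Require Import structures.
From mathcomp Require Import all_order perm ring.
Set Implicit Arguments.
Unset Strict Implicit.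
Unset Printing Implicit Defensive.
Import Order.TTheory GRing.Theory Num.Theory.
Local Open Scope ring_scope.

(** The rational map is inverted by linear algebra: the linear syzygies of the
    quadrics, evaluated at the value F(x) of the map, are linear equations for
    x, and off the secant variety they have x as their only solution.

    Write a linear syzygy as a bilinear form B_k(y, z) = y *m B_k *m z^T, which
    vanishes at y = F(z), and stack the linear forms B_k(y, -) as the rows of
    a matrix L(y). Condition K_2 makes a finite list of linear syzygies
    generate the Koszul syzygies ([koszul_linear_matrices]); hence for any y,
      L(y) z = 0  implies that F(z) is proportional to y,
    while L(F(z)) z = 0 always holds. So for y = F(x) <> 0 the kernel of L(y)
    contains x, and on this kernel F is a multiple q.y of the constant vector
    y by one quadratic form q with q(x) <> 0. If the kernel is larger than the
    point x, it contains a line through x, which X meets in the zero scheme of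
    q, of length 2. Conversely, if X meets a line through x in length at least
    2, then all F_i restricted to that line are multiples of one quadric q:
    two independent binary quadrics have at most one point, counted with
    multiplicity, in common. Dividing the syzygies by q shows that the line
    lies in the kernel of L(F(x)). Altogether ([SecE]), for F(x) <> 0,
      x is outside Sec X  if and only if  L(F(x)) has corank 1.

    The rest is explicit. The kernel of a matrix with n + 1 columns and rank n
    is spanned by the vector of signed maximal minors of n suitable rows
    ([cross]). Let v_t(y) be this vector for the rows of L(y) selected by t;
    its coordinates are forms in y. The domain of the embedding is the locus
    where some F_i(x) v_t(F(x)) does not vanish. The image is the locus where
    L(y) v_t(y) = 0 for all t and F(v_t(y)) <> 0 for some t, since then v_t(y)
    is a preimage of y. The inverse map is locally y |-> v_t(y). *)

(** * Maximal minors and kernels of corank one *)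

(** The (n+1)-dimensional cross product: signed maximal minors, as the cofactors
    along a row added on top. *)
Definition cross (R : comNzRingType) n (A : 'M[R]_(n, n.+1)) : 'rV[R]_n.+1 :=
  \row_j cofactor (col_mx (0 : 'rV_n.+1) A : 'M_(1 + n)) ord0 j.

Lemma cross_dot (R : comNzRingType) n (A : 'M[R]_(n, n.+1)) (r : 'rV[R]_n.+1) :
  (r *m (cross A)^T) 0 0 = \det (col_mx r A : 'M_(1 + n)).
Proof.
rewrite (expand_det_row _ ord0) mxE; apply: eq_bigr => j _; rewrite !mxE.
case: splitP => //= k _; rewrite ord1; congr (_ * (_ * \det _)).
apply/matrixP => a b; rewrite !mxE.
by case: splitP => // l /= /esym; case: l => [[]].
Qed.

(** The product of row i of A with [cross A] is a determinant in which row i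
    occurs twice. *)
Lemma cross_ortho (R : comNzRingType) n (A : 'M[R]_(n, n.+1)) :
  cross A *m A^T = 0.
Proof.
apply: trmx_inj; rewrite trmx_mul trmxK trmx0.
apply/row_matrixP => i; rewrite row_mul row0; apply/rowP => j.
rewrite ord1 cross_dot mxE.
rewrite (@determinant_alternate _ _ _ (lshift n ord0) (rshift 1 i)) // => k.
by rewrite col_mxEu col_mxEd mxE.
Qed.

(** The minors of A are the determinants of A extended by a coordinate vector;
    one of them is nonzero exactly when A extends to an invertible matrix. *)
Lemma cross_neq0 (K : fieldType) n (A : 'M[K]_(n, n.+1)) :
  (cross A != 0) = row_free A.
Proof.
have det_free r : (\det (col_mx r A : 'M_(1 + n)) != 0) = row_free (col_mx r A).
  by rewrite -unitfE; apply/esym; exact: (@row_free_unit _ n.+1).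
apply/idP/idP => [/rV0Pn[j nz]|freeA].
  have: row_free (col_mx (delta_mx 0 j : 'rV_n.+1) A).
    by rewrite -det_free -cross_dot -rowE !mxE; rewrite mxE in nz.
  move=> fr; apply: inj_row_free => u uA.
  have /eqP : row_mx (0 : 'M_1) u = 0.
    by apply: (row_free_inj fr); rewrite mul_row_col uA !mul0mx addr0.
  by rewrite row_mx_eq0 => /andP[_ /eqP].
have /row_subPn[i ni] : ~~ ((1%:M : 'M[K]_n.+1) <= A)%MS.
  apply/negP => /mxrankS; rewrite mxrank1 leqNgt ltnS.
  by rewrite rank_leq_row.
have: row_free (col_mx (row i 1%:M) A).
  rewrite -row_leq_rank -addsmxE add1n -[X in (X < _)%N](eqP freeA).
  have: (A < row i 1%:M + A)%MS.
    by rewrite ltmxE addsmxSr addsmx_sub submx_refl andbT.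
  by rewrite ltmxErank => /andP[].
rewrite -det_free -cross_dot; apply: contraNneq => ->.
by rewrite trmx0 mulmx0 mxE.
Qed.

Lemma map_cross (R S : comNzRingType) (f : {rmorphism R -> S}) n
    (A : 'M[R]_(n, n.+1)) : map_mx f (cross A) = cross (map_mx f A).
Proof.
apply/rowP => j; rewrite !mxE -cofactor_map_mx; congr cofactor.
by rewrite map_col_mx map_mx0.
Qed.

Lemma kernel_corank1 (K : fieldType) m n (L : 'M[K]_(m, n.+1)) (x z : 'rV_n.+1) :
  \rank L = n -> x != 0 -> x *m L^T = 0 -> z *m L^T = 0 -> (z <= x)%MS.
Proof.
move=> rL x0 /sub_kermxP xL /sub_kermxP /submx_trans -> //.
rewrite -(geq_leqif (mxrank_leqif_sup xL)) rank_rV x0 mxrank_ker mxrank_tr.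
by rewrite rL subSn ?subnn.
Qed.

Lemma kernel_sub_cross (K : fieldType) m n (L : 'M[K]_(m, n.+1))
    (t : 'I_n -> 'I_m) (z : 'rV_n.+1) :
  cross (rowsub t L) != 0 -> z *m L^T = 0 -> (z <= cross (rowsub t L))%MS.
Proof.
set A := rowsub t L; move=> nz zL.
have zA : z *m A^T = 0.
  apply/rowP => j.
  have /rowP/(_ (t j)) := zL; rewrite !mxE => e.
  by rewrite -[RHS]e; apply: eq_bigr => k _; rewrite !mxE.
have rA : \rank A = n by apply/eqP; move: nz; rewrite cross_neq0.
exact: kernel_corank1 rA nz (cross_ortho A) zA.
Qed.

Lemma rank_cross (K : fieldType) m n (L : 'M[K]_(m, n.+1)) (t : 'I_n -> 'I_m) :
  cross (rowsub t L) != 0 -> (n <= \rank L)%N.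
Proof.
rewrite cross_neq0 => /eqP rt; rewrite -[X in (X <= _)%N]rt; apply: mxrankS.
by apply/row_subP => i; rewrite row_rowsub row_sub.
Qed.

(** The selections of rows are taken in a finite type so that a disjunction
    over them remains decidable. *)
Lemma exists_cross (K : fieldType) m n (L : 'M[K]_(m, n.+1)) :
  \rank L = n -> exists t : {ffun 'I_n -> 'I_m}, cross (rowsub t L) != 0.
Proof.
move=> rL; pose t := maxrankfun L \o cast_ord (esym rL); exists (finfun t).
have -> : rowsub (finfun t) L = rowsub t L.
  by apply/matrixP => i j; rewrite !mxE ffunE.
by rewrite cross_neq0 rowsub_comp rowsub_cast row_free_castmx maxrowsub_free.
Qed.

Lemma cross_in_kernel (K : fieldType) m n (L : 'M[K]_(m, n.+1)) (t : 'I_n -> 'I_m)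
    (x : 'rV_n.+1) :
  x != 0 -> x *m L^T = 0 -> cross (rowsub t L) *m L^T = 0.
Proof.
move=> x0 xL; have [->|nz] := eqVneq (cross (rowsub t L)) 0; first by rewrite mul0mx.
have /sub_rVP[b xE] := kernel_sub_cross nz xL.
have b0 : b != 0 by apply: contraNneq x0 => b0; rewrite xE b0 scale0r.
by apply/eqP; move/eqP: xL; rewrite xE -scalemxAl scaler_eq0 (negPf b0).
Qed.
(** * Homogeneous forms *)

Section Forms.
Variable K : fieldType.

Lemma homog_prod_const n e (I : finType) (G : I -> {mpoly K[n]}) :
  (forall i, G i \is e.-homog) -> \prod_i G i \is (e * #|I|).-homog.
Proof.
move=> hG; rewrite cardT /index_enum -enumT.
elim: (enum I) => [|i r IH]; first by rewrite big_nil muln0 dhomog1.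
by rewrite big_cons /= mulnS dhomogM.
Qed.

Lemma homog_det n e k (M : 'M[{mpoly K[n]}]_k) :
  (forall i j, M i j \is e.-homog) -> \det M \is (e * k).-homog.
Proof.
move=> hM; rewrite /determinant; apply: rpred_sum => s _.
rewrite mulr_sign; have h : \prod_i M i (s i) \is (e * k).-homog.
  by rewrite -[k in (e * k)%N]card_ord; apply: homog_prod_const.
by case: ifP; rewrite // rpredN.
Qed.

Lemma homog_cross n e k (M : 'M[{mpoly K[n]}]_(k, k.+1)) j :
  (forall i j, M i j \is e.-homog) -> cross M 0 j \is (e * k).-homog.
Proof.
move=> hM; rewrite mxE /cofactor -signr_odd mulr_sign.
set D := \det _; have h : D \is (e * k).-homog.
  by apply: homog_det => a b; rewrite !mxE; case: splitP => // l; rewrite ord1.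
by case: ifP; rewrite // rpredN.
Qed.

Lemma homog_comp n r d e (p : {mpoly K[n]}) (h : n.-tuple {mpoly K[r]}) :
  p \is d.-homog -> (forall i, tnth h i \is e.-homog) ->
  p \mPo h \is (d * e).-homog.
Proof.
move=> hp hh; rewrite comp_mpolyEX big_seq; apply: rpred_sum => m mp.
apply: rpredZ; rewrite comp_mpolyX -(dhomog_mf hp mp) /= mdegE.
elim/big_ind2: _ => [|p1 a p2 b h1 h2|i _]; first exact: dhomog1.
  by rewrite mulnDl dhomogM.
by rewrite mulnC dhomogMn.
Qed.

Lemma meval_scale n d (p : {mpoly K[n]}) (c : K) (x : 'I_n -> K) :
  p \is d.-homog -> p.@[fun i => c * x i] = c ^+ d * p.@[x].
Proof.
move=> hp; rewrite !mevalE mulr_sumr; apply: eq_big_seq => m mp.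
rewrite mulrCA; congr (_ * _); rewrite -(dhomog_mf hp mp) /= mdegE.
by rewrite -prodrXr -big_split; apply: eq_bigr => i _; rewrite exprMn.
Qed.

(** Forms of degree d are spanned by monomials; this reduces linear statements
    about forms to monomials. *)
Lemma homog_ind n d (P : {mpoly K[n]} -> Prop) :
  P 0 -> (forall p q, P p -> P q -> P (p + q)) ->
  (forall c p, P p -> P (c *: p)) ->
  (forall m, mdeg m = d -> P 'X_[m]) -> forall p, p \is d.-homog -> P p.
Proof.
move=> P0 PD PZ PX p hp; rewrite [p]mpolyE.
elim: (msupp p) (dhomog_mf hp) => [|m r IH] hr; first by rewrite big_nil.
rewrite big_cons; apply: (PD); last first.
  by apply: IH => l lr; apply: hr; rewrite inE lr orbT.
by apply/PZ/PX/hr; rewrite inE eqxx.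
Qed.

Lemma mdegS n d (m : 'X_{1..n}) : mdeg m = d.+1 ->
  exists i m', m = (U_(i) + m')%MM /\ mdeg m' = d.
Proof.
move=> dm; have /existsP[i mi] : [exists i, m i != 0%N].
  rewrite -negb_forall; apply: contra_eqN dm => /forallP h.
  by rewrite mdegE big1 // => i _; apply/eqP/h.
have le_im : (U_(i) <= m)%MM.
  by apply/mnm_lepP => j; rewrite mnm1E; case: eqP => [<-|]; rewrite ?lt0n.
exists i, (m - U_(i))%MM; rewrite addmC submK //; split=> //.
by move: dm; rewrite -{1}(submK le_im) mdegD mdeg1 addn1 => -[].
Qed.

Lemma meval_linear n (p : {mpoly K[n]}) (z : 'I_n -> K) : p \is 1.-homog ->
  p.@[z] = \sum_j p@_U_(j) * z j.
Proof.
move: p; apply: homog_ind => [|p q hp hq|c p hp|m].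
- by rewrite meval0 big1 // => j _; rewrite mcoeff0 mul0r.
- by rewrite mevalD hp hq -big_split; apply: eq_bigr => j _; rewrite mcoeffD mulrDl.
- by rewrite mevalZ hp mulr_sumr; apply: eq_bigr => j _; rewrite mcoeffZ mulrA.
move=> /eqP/mdeg1P[i /eqP ->]; rewrite mevalXU (bigD1 i) //= mcoeffXU eqxx mul1r.
by rewrite big1 ?addr0 // => j ji; rewrite mcoeffXU eq_sym (negPf ji) mul0r.
Qed.

End Forms.

(** * Koszul syzygies and linear syzygies *)

Section Syz.
Variables (K : fieldType) (n s : nat).
Implicit Types (F : 'I_s -> {mpoly K[n.+1]}).

(** Each Koszul syzygy comes with its own family of linear syzygies; the finite
    union of these families serves for all of them at once. Contracting a
    Koszul syzygy with y gives the 2 x 2 minor y_i F_j - y_j F_i, so a common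
    zero z of the linear syzygies contracted with y makes F(z) proportional
    to y. *)
Lemma koszul_linear_matrices F d : condition_K F d ->
  exists m (B : 'I_m -> 'M[K]_(s, n.+1)),
    (forall k (z : 'rV_n.+1),
       (\row_i (F i).@[z 0]) *m B k *m z^T = 0) /\
    (forall (y : 'rV_s) (z : 'rV_n.+1),
       (forall k, y *m B k *m z^T = 0) ->
       forall i j, y 0 i * (F j).@[z 0] = y 0 j * (F i).@[z 0]).
Proof.
case=> _ kF.
have /fin_all_exists[m /fin_all_exists[b /fin_all_exists[c bcP]]] :
    forall ij : 'I_s * 'I_s, exists m b c,
      (forall k : 'I_m, linear_syzygy F (b k)) /\
      koszul_syzygy F ij.1 ij.2 = \sum_k c k *: b k by move=> [i j]; apply: kF.
pose T : finType := {ij : 'I_s * 'I_s & 'I_(m ij)}.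
pose a (k : T) := b (tag k) (tagged k).
have aP k : linear_syzygy F (a k) by apply: (bcP (tag k)).1.
pose B (k : T) : 'M[K]_(s, n.+1) := \matrix_(i, j) (a k 0 i)@_U_(j).
have BE k (y : 'rV_s) (z : 'rV_n.+1) :
    (y *m B k *m z^T) 0 0 = \sum_i y 0 i * (a k 0 i).@[z 0].
  rewrite -mulmxA mxE; apply: eq_bigr => i _; congr (_ * _).
  rewrite mxE (meval_linear _ ((aP k).2 i)).
  by apply: eq_bigr => j _; rewrite !mxE.
exists #|T|, (fun k => B (enum_val k)); split=> [k z|y z yz].
  apply/rowP => j; rewrite ord1 BE [RHS]mxE.
  have := congr1 (meval (z 0)) (aP (enum_val k)).1.
  rewrite meval0 => e; rewrite -[RHS]e raddf_sum; apply: eq_bigr => i _.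
  by rewrite mxE /= mevalM mulrC.
move=> i j.
have az (k : T) : \sum_i y 0 i * (a k 0 i).@[z 0] = 0.
  by rewrite -BE -[k]enum_rankK yz mxE.
have kz : \sum_l y 0 l * (koszul_syzygy F i j 0 l).@[z 0] = 0.
  have -> := (bcP (i, j)).2 => /=.
  under eq_bigr do rewrite summxE raddf_sum mulr_sumr.
  rewrite exchange_big big1 //= => k _.
  have := congr1 ( *%R (c (i, j) k).@[z 0]) (az (Tagged (fun ij => 'I_(m ij)) k)).
  rewrite mulr0 mulr_sumr => e; rewrite -[RHS]e.
  by apply: eq_bigr => l _; rewrite mxE /= mevalM mulrCA.
apply/eqP; rewrite -subr_eq0 -[X in _ == X]kz; apply/eqP.
rewrite /koszul_syzygy.
under [RHS]eq_bigr do rewrite !mxE eqxx /= mevalB !mevalM !rmorph_nat mulrBr !mulrA.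
have pick (i' : 'I_s) (v : 'I_s -> K) : \sum_l v l * (l == i')%:R = v i'.
  rewrite (bigD1 i') //= eqxx mulr1 big1 ?addr0 // => l /negPf ->.
  by rewrite mulr0.
by rewrite sumrB !pick.
Qed.
End Syz.

(** * Coordinates on a line through a point *)

Section Frame.
Variables (K : fieldType) (n : nat).
Implicit Types (x w : 'rV[K]_n.+1) (A : 'M[K]_(2, n.+1)) (p : {mpoly K[n.+1]}).

(** A basis (x, w) of the line A, chosen so that w has i-th coordinate 0 and
    x does not: then the coordinates on the line are given by explicit linear
    forms, 'X_i up to a constant and a combination of 'X_k and 'X_i. *)
Definition adapted_frame A x w i k :=
  [/\ x 0 i != 0, w 0 i = 0, w 0 k != 0
    & forall z : 'rV_n.+1, (z <= A)%MS <-> exists a b, z = a *: x + b *: w].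

Lemma adapted_frame_col_mx x v : x != 0 -> ~~ (v <= x)%MS ->
  exists i k w, adapted_frame (col_mx x v) x w i k /\ exists c, w = v - c *: x.
Proof.
move=> /rV0Pn[i xi] vx; pose w := v - (v 0 i / x 0 i) *: x.
have /rV0Pn[k wk] : w != 0.
  by apply: contra vx; rewrite subr_eq0 => /eqP ->; apply: scalemx_sub.
exists i, k, w; split; last by exists (v 0 i / x 0 i).
split=> // [|z]; first by rewrite !mxE divfK // subrr.
have -> : (z <= (col_mx x v : 'M_(2, _)))%MS = (z <= x + v)%MS by rewrite addsmxE.
split=> [|[a [b ->]]].
  move=> /sub_addsmxP[[a b] /= ->].
  exists (a 0 0 + b 0 0 * (v 0 i / x 0 i)), (b 0 0).
  rewrite [a]mx11_scalar [b]mx11_scalar !mul_scalar_mx !mxE !eqxx !mulr1n.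
  by rewrite scalerBr scalerDl scalerA [_ *: v - _]addrC addrA addrK.
rewrite addmx_sub ?scalemx_sub ?addsmxSl // addmx_sub ?addsmxSr //.
by rewrite -scaleNr scalemx_sub ?addsmxSl.
Qed.

Lemma rank_col_mx2 x (v : 'rV_n.+1) : x != 0 -> ~~ (v <= x)%MS -> \rank (col_mx x v) = 2.
Proof.
move=> x0 vx; apply/eqP; rewrite eqn_leq rank_leq_row -addsmxE /=.
have: (x < x + v)%MS by rewrite ltmxE addsmxSl addsmx_sub submx_refl.
by rewrite ltmxErank rank_rV x0 => /andP[].
Qed.

Lemma adapted_frame_of_line A x : \rank A = 2 -> (x <= A)%MS -> x != 0 ->
  exists i k w, adapted_frame A x w i k.
Proof.
move=> rA xA x0.
have /row_subPn[l lx] : ~~ (A <= x)%MS.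
  by apply/negP => /mxrankS; rewrite rA rank_rV x0.
have [i [k [w [[xi wi wk fr] _]]]] := adapted_frame_col_mx x0 lx.
exists i, k, w; split=> // z; rewrite -fr.
suff /eqmxP e : (col_mx x (row l A) == A)%MS by rewrite e.
have sub : (col_mx x (row l A) <= A)%MS by rewrite col_mx_sub xA row_sub.
by rewrite sub /= -(geq_leqif (mxrank_leqif_sup sub)) rA rank_col_mx2.
Qed.

Section Coordinates.
Variables (A : 'M[K]_(2, n.+1)) (x w : 'rV[K]_n.+1) (i k : 'I_n.+1).
Hypothesis fr : adapted_frame A x w i k.

Definition coordU : {mpoly K[n.+1]} := (x 0 i)^-1 *: 'X_i.
Definition coordV : {mpoly K[n.+1]} :=
  (w 0 k)^-1 *: ('X_k - x 0 k *: coordU).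

Lemma coordUE a b : coordU.@[(a *: x + b *: w) 0] = a.
Proof.
case: fr => xi wi _ _.
by rewrite mevalZ mevalXU !mxE wi mulr0 addr0 mulrC mulfK.
Qed.

Lemma coordVE a b : coordV.@[(a *: x + b *: w) 0] = b.
Proof.
case: fr => xi wi wk _; rewrite mevalZ mevalB mevalZ coordUE mevalXU !mxE.
by rewrite [x 0 k * a]mulrC [_ + b * _]addrC addrK mulrC mulfK.
Qed.

Lemma homogU : coordU \is 1.-homog.
Proof. by rewrite dhomogZ ?dhomogX /= ?mdeg1. Qed.

Lemma homogV : coordV \is 1.-homog.
Proof. by rewrite dhomogZ // rpredB ?dhomogZ ?homogU // dhomogX /= mdeg1. Qed.

Lemma frame_line_ideal p :
  (forall a b, p.@[(a *: x + b *: w) 0] = 0) -> line_ideal A p.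
Proof. by case: fr => _ _ _ h pz z /h[a [b ->]]. Qed.

End Coordinates.

Lemma quadric_on_line x w p : p \is 2.-homog ->
  exists c, forall a b, p.@[(a *: x + b *: w) 0] =
    p.@[x 0] * a ^+ 2 + c * (a * b) + p.@[w 0] * b ^+ 2.
Proof.
move=> hp; suff [al [c [ga e]]] : exists al c ga, forall a b,
    p.@[(a *: x + b *: w) 0] = al * a ^+ 2 + c * (a * b) + ga * b ^+ 2.
  exists c => a b; rewrite e.
  have := e 1 0; have := e 0 1; rewrite !scale1r !scale0r addr0 add0r => -> ->.
  by ring.
move: p hp; apply: homog_ind => [|p q [a1 [c1 [g1 e1]]] [a2 [c2 [g2 e2]]]
  |t p [a1 [c1 [g1 e1]]]|m].
- by exists 0, 0, 0 => a b; rewrite meval0; ring.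
- by exists (a1 + a2), (c1 + c2), (g1 + g2) => a b; rewrite mevalD e1 e2; ring.
- by exists (t * a1), (t * c1), (t * g1) => a b; rewrite mevalZ e1; ring.
case/mdegS=> i [m' [-> /eqP/mdeg1P[j /eqP ->]]].
exists (x 0 i * x 0 j), (x 0 i * w 0 j + x 0 j * w 0 i), (w 0 i * w 0 j) => a b.
by rewrite mpolyXD mevalM !mevalXU !mxE; ring.
Qed.

End Frame.

(** * Quadrics on a line meeting the scheme in length two *)

Section Length.
Variables (K : fieldType) (n : nat).
Implicit Types (I J : {mpoly K[n.+1]} -> Prop) (p q : {mpoly K[n.+1]}).
Implicit Types (A : 'M[K]_(2, n.+1)).

Lemma idealZ I c p : is_ideal I -> I p -> I (c *: p).
Proof. by case=> _ _ IM Ip; rewrite -mul_mpolyC; apply: IM. Qed.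

Lemma line_ideal_is_ideal A : is_ideal (line_ideal A).
Proof.
split=> [x _|p q Ip Iq x xA|p q Iq x xA]; first exact: meval0.
  by rewrite mevalD Ip // Iq // addr0.
by rewrite mevalM Iq // mulr0.
Qed.

Lemma sum_ideal_is_ideal I J :
  is_ideal I -> is_ideal J -> is_ideal (sum_ideal I J).
Proof.
move=> [I0 ID IM] [J0 JD JM]; split.
- by exists 0, 0; rewrite addr0.
- move=> _ _ [p1 [q1 [h1 h2 ->]]] [p2 [q2 [h3 h4 ->]]].
  by exists (p1 + p2), (q1 + q2); rewrite addrACA; split; auto.
by move=> p _ [p1 [q1 [h1 h2 ->]]]; exists (p * p1), (p * q1); rewrite mulrDr; split; auto.
Qed.

(** If modulo I each degree d.+2 is spanned by a single form [e d], then two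
    forms of equal large degree are never independent modulo I. It is enough
    to know the products of two variables, and how multiplication by a
    variable moves [e d] to [e d.+1]. *)
Lemma length_le1 I (e : nat -> {mpoly K[n.+1]}) : is_ideal I ->
  (forall i j, exists c, I ('X_i * 'X_j - c *: e 0)) ->
  (forall d j, exists c, I ('X_j * e d - c *: e d.+1)) ->
  ~ length_at_least 2 I.
Proof.
move=> idI e0 eS [N] /(_ N.+2 (leqW (leqnSn N))) [p [hp indep]].
have [I0 ID IM] := idI.
have monom d m : mdeg m = d.+2 -> exists c, I ('X_[m] - c *: e d).
  elim: d m => [|d IH] m /mdegS[i [m' [-> dm']]].
    move: dm' => /eqP/mdeg1P[j /eqP ->].
    by have [c Ic] := e0 i j; exists c; rewrite mpolyXD.
  have [c Ic] := IH _ dm'; have [c' Ic'] := eS d i; exists (c * c').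
  have -> : 'X_[U_(i) + m'] - (c * c') *: e d.+1 =
      'X_i * ('X_[m'] - c *: e d) + c *: ('X_i * e d - c' *: e d.+1).
    by rewrite mpolyXD mulrBr scalerBr scalerA -scalerAr addrA subrK.
  by apply: (ID); [apply: IM | apply: idealZ].
have form d q : q \is d.+2.-homog -> exists c, I (q - c *: e d).
  move: q; apply: homog_ind => [|q r [a Ia] [b Ib]|t q [a Ia]|m]; last exact: monom.
  - by exists 0; rewrite scale0r subr0.
  - by exists (a + b); rewrite scalerDl opprD addrACA; apply: ID.
  by exists (t * a); rewrite -scalerA -scalerBr; apply: idealZ.
have [c0 I_0] := form _ _ (hp 0); have [c1 I_1] := form _ _ (hp 1).
have h := indep (fun i => if i == 0 then c1 else - c0).
have [/eqP c00 c10] : - c0 = 0 /\ c1 = 0.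
  suff h' : I (\sum_i (if i == 0 then c1 else - c0) *: p i).
    by split; [apply: (h h' 1) | apply: (h h' 0)].
  rewrite big_ord_recl big_ord1 /=.
  have -> : c1 *: p 0 + - c0 *: p (lift ord0 ord0) =
     c1 *: (p 0 - c0 *: e N) + (- c0) *: (p 1 - c1 *: e N).
    have -> : lift ord0 ord0 = 1 :> 'I_2 by apply/val_inj.
    rewrite !scalerBr !scalerA mulNr !scaleNr opprK addrACA.
    by rewrite [c1 * c0]mulrC addNr addr0.
  by apply: (ID); apply: idealZ.
have /(_ _ 0) := indep (fun i => (i == 0)%:R).
rewrite big_ord_recl big_ord1 /= scale1r scale0r addr0.
move: I_0 c00; rewrite oppr_eq0 => I_0 /eqP c00.
move: I_0; rewrite c00 scale0r subr0 => I_0 /(_ I_0) /eqP.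
by rewrite oner_eq0.
Qed.

Section Pencil.
Variables (X : closed_subscheme K n) (A : 'M[K]_(2, n.+1)).
Variables (x w : 'rV[K]_n.+1) (i k : 'I_n.+1).
Hypothesis fr : adapted_frame A x w i k.

Let S := sum_ideal X (line_ideal A).

(** Modulo the ideal of the line only the values on the line matter. *)
Lemma mem_sum_ideal p q : X q ->
  (forall a b, p.@[(a *: x + b *: w) 0] = q.@[(a *: x + b *: w) 0]) -> S p.
Proof.
move=> Xq pq; exists q, (p - q); rewrite [q + _]addrC subrK; split=> //.
by apply: (frame_line_ideal fr) => a b; rewrite mevalB pq subrr.
Qed.

(** In coordinates (a, b) on the line, g = gc ab + g2 b^2 since g vanishes at
    x = (1, 0), while f contains a^2. If g is nonzero, the relations f = g = 0
    reduce every form of degree at least 2 to a multiple of b^d when gc is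
    nonzero, and of a^(d-1) b otherwise, so the length is at most 1. *)
Lemma vanish_on_secant_line f g : X f -> X g -> f \is 2.-homog -> g \is 2.-homog ->
  f.@[x 0] != 0 -> g.@[x 0] = 0 -> length_at_least 2 S ->
  forall z : 'rV_n.+1, (z <= A)%MS -> g.@[z 0] = 0.
Proof.
move=> Xf Xg hf hg f0 g0 len.
have idS : is_ideal S.
  by apply: sum_ideal_is_ideal; [exact: ideal_ofP | exact: line_ideal_is_ideal].
have [X0 XD XM] := ideal_ofP X.
have [fc fE] := quadric_on_line x w hf; have [gc gE] := quadric_on_line x w hg.
have quad j l : exists c, forall a b, ('X_j * 'X_l).@[(a *: x + b *: w) 0] =
    x 0 j * x 0 l * a ^+ 2 + c * (a * b) + w 0 j * w 0 l * b ^+ 2.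
  exists (x 0 j * w 0 l + w 0 j * x 0 l) => a b.
  by rewrite mevalM !mevalXU !mxE; ring.
set f2 := f.@[w 0] in fE; set g2 := g.@[w 0] in gE; set f_0 := f.@[x 0] in f0 fE.
have [gc0|gc0] := eqVneq gc 0; last first.
  (* ab is a multiple of b^2, hence so is a^2. *)
  case: (@length_le1 S (fun d => coordV x w i k ^+ d.+2) idS) => // [j l|d j].
    have [c cE] := quad j l; set u := x 0 j * x 0 l in cE.
    set v := w 0 j * w 0 l in cE.
    exists (v - u * f2 / f_0 - (c - u * fc / f_0) / gc * g2).
    apply: (@mem_sum_ideal _ (u / f_0 *: f + (c - u * fc / f_0) / gc *: g)).
      by apply: (XD); apply: idealZ => //; exact: ideal_ofP.
    move=> a b; rewrite mevalB cE mevalZ rmorphXn /= (coordVE fr).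
    rewrite mevalD !mevalZ fE gE g0.
    by field; rewrite f0 gc0.
  exists (w 0 j - x 0 j * g2 / gc).
  apply: (@mem_sum_ideal _ (coordV x w i k ^+ d.+1 * (x 0 j / gc *: g))).
    by apply: XM; apply: idealZ => //; exact: ideal_ofP.
  move=> a b; rewrite mevalB mevalM mevalZ mevalXU !rmorphXn /= (coordVE fr).
  rewrite mevalM rmorphXn /= (coordVE fr) mevalZ gE g0 !mxE !exprS.
  by field.
have [g20|g20] := eqVneq g2 0.
  case: fr => _ _ _ h z /h[a [b ->]].
  by rewrite gE g0 gc0 g20; ring.
(* Now b^2 = 0, and a^2 is a multiple of ab. *)
case: (@length_le1 S (fun d => coordU x i ^+ d.+1 * coordV x w i k) idS)
  => // [j l|d j].
  have [c cE] := quad j l; set u := x 0 j * x 0 l in cE.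
  set v := w 0 j * w 0 l in cE.
  exists (c - u * fc / f_0).
  apply: (@mem_sum_ideal _ (u / f_0 *: f + (v - u * f2 / f_0) / g2 *: g)).
    by apply: (XD); apply: idealZ => //; exact: ideal_ofP.
  move=> a b; rewrite mevalB cE mevalZ mevalM rmorphXn /= (coordVE fr) (coordUE fr).
  rewrite mevalD !mevalZ fE gE g0 gc0.
  by field; rewrite f0 g20.
exists (x 0 j).
apply: (@mem_sum_ideal _ (coordU x i ^+ d.+1 * (w 0 j / g2 *: g))).
  by apply: XM; apply: idealZ => //; exact: ideal_ofP.
move=> a b; rewrite mevalB !mevalM mevalZ !mevalM mevalXU !rmorphXn /=.
rewrite (coordVE fr) (coordUE fr).
rewrite mevalZ gE g0 gc0 !mxE !exprS.
by field.
Qed.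

End Pencil.
End Length.

(** * Lines on which the quadrics are proportional *)

Section Secant.
Variables (K : numFieldType) (n : nat).
Implicit Types (p q : {mpoly K[n.+1]}).

Lemma poly_eq0_of_values (r : {poly K}) : (forall t, r.[t] = 0) -> r = 0.
Proof.
move=> r0; apply/eqP; apply: contraT => nz.
have := @max_poly_roots _ r [seq i%:R | i <- iota 0 (size r)] nz.
rewrite size_map size_iota ltnn; apply; first by apply/allP => t _; rewrite rootE r0.
by rewrite map_inj_uniq ?iota_uniq //; apply: mulrIn; rewrite oner_eq0.
Qed.

(** Restriction to the line through w and x in the affine coordinate T of the
    point T x + w. With x at infinity, a quadric that does not vanish at x
    restricts to a polynomial of degree exactly 2. *)
Definition restrict (x w : 'rV[K]_n.+1) p : {poly K} :=
  mmap polyC (fun i => x 0 i *: 'X + (w 0 i)%:P) p.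

HB.instance Definition _ x w := GRing.RMorphism.copy (restrict x w)
  (mmap polyC (fun i => x 0 i *: 'X + (w 0 i)%:P)).

Lemma restrictE x w p t : (restrict x w p).[t] = p.@[(t *: x + w) 0].
Proof.
rewrite /restrict /mmap horner_sum mevalE; apply: eq_bigr => m _.
rewrite hornerM hornerC horner_prod; congr (_ * _); apply: eq_bigr => j _.
by rewrite horner_exp !hornerE !mxE mulrC.
Qed.

(** On the line, the ideal of X is contained in (f) up to saturation, and f
    restricts to a polynomial of degree 2. The forms V^d and U V^(d-1) restrict
    to 1 and T, which are independent modulo such a polynomial. *)
Lemma length_ge2_of_proportional (X : closed_subscheme K n) s (F : 'I_s -> {mpoly K[n.+1]})
    (A : 'M[K]_(2, n.+1)) x w i k f (c : 'I_s -> K) :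
  adapted_frame A x w i k -> scheme_defined_by X F -> f \is 2.-homog ->
  f.@[x 0] != 0 ->
  (forall l (z : 'rV_n.+1), (z <= A)%MS -> (F l).@[z 0] = c l * f.@[z 0]) ->
  length_at_least 2 (sum_ideal X (line_ideal A)).
Proof.
move=> fr XF hf f0 cF; exists 1%N => -[//|d] _.
have [xi wi wk frP] := fr.
have onA t : ((t *: x + w)%R <= A)%MS by apply/frP; exists t, 1; rewrite scale1r.
pose rho : {rmorphism {mpoly K[n.+1]} -> {poly K}} := restrict x w.
(* V is 1 and U is T at T x + w. *)
exists (fun j => if j == 0 then coordV x w i k ^+ d.+1
                 else coordU x i * coordV x w i k ^+ d).
split=> [j|b [q [r [Xq Ar bqr]]]].
  have hV e : coordV x w i k ^+ e \is e.-homog.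
    by have := dhomogMn e (homogV x w i k); rewrite mul1n.
  by case: ifP => _; [exact: hV | exact: dhomogM (homogU x i) (hV d)].
have rhoq : rho q = (b 0)%:P + b 1 *: 'X.
  apply/eqP; rewrite -subr_eq0; apply/eqP/poly_eq0_of_values => t.
  rewrite !hornerE restrictE.
  have /eqP := congr1 (meval ((t *: x + w) 0)) bqr.
  rewrite big_ord_recl big_ord1 /= !mevalD !mevalZ mevalM !rmorphXn /=.
  rewrite -[w in t *: x + w]scale1r (coordUE fr) (coordVE fr) scale1r.
  rewrite (Ar _ (onA t)) addr0 => /eqP <-.
  have -> : lift ord0 ord0 = 1 :> 'I_2 by apply/val_inj.
  by rewrite !expr1n !mulr1 subrr.
have rhoF l : rho (F l) = c l *: rho f.
  apply/eqP; rewrite -subr_eq0; apply/eqP/poly_eq0_of_values => t.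
  by rewrite !hornerE !restrictE cF ?subrr.
have [N XN] := (XF q).1 Xq.
have dvd l : rho f %| rho 'X_l ^+ N * rho q.
  have [a e] := XN l; have := congr1 rho e; rewrite rmorphM rmorphXn rmorph_sum /= => ->.
  elim/big_ind: _ => [|u v|l' _]; [exact: dvdp0|exact: dvdp_add|].
  by rewrite rmorphM rhoF dvdp_mull // -mul_polyC dvdp_mull.
have rhoX l : rho 'X_l = x 0 l *: 'X + (w 0 l)%:P.
  by rewrite /rho /= /restrict mmapX mmap1U.
have size_f : size (rho f) = 3.
  have [g gE] := quadric_on_line x w hf.
  have -> : rho f = Poly [:: f.@[w 0]; g; f.@[x 0]].
    apply/eqP; rewrite -subr_eq0; apply/eqP/poly_eq0_of_values => t.
    rewrite hornerD hornerN horner_Poly restrictE.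
    by have := gE t 1; rewrite scale1r => -> /=; ring.
  by rewrite (@PolyK _ 0).
(* The variables 'X_i and 'X_k have no common zero on the line, so that the
   saturation exponent can be removed. *)
have cop : coprimep (rho 'X_i ^+ N) (rho 'X_k ^+ N).
  apply/coprimep_expl/coprimep_expr; rewrite !rhoX wi addr0 coprimepZl //.
  rewrite coprimep_sym coprimepX /root !hornerE //.
have /eqP rq0 : rho q == 0.
  have : rho f %| rho q.
    have /Bezout_coprimepP[[u v] /= uv] := cop.
    rewrite -[rho q]mul1r -(eqp_dvdr _ (eqp_mulr _ uv)) mulrDl -!mulrA.
    by apply: dvdp_add; apply/dvdp_mull/dvd.
  apply: contraLR => nz; apply/negP => /(dvdp_leq nz); rewrite size_f rhoq.
  rewrite leqNgt => /negP; apply; rewrite ltnS (leq_trans (size_polyD _ _)) //.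
  rewrite geq_max (leq_trans (size_polyC_leq1 _)) //.
  by rewrite (leq_trans (size_scale_leq _ _)) ?size_polyX.
have b0 : b 0 = 0.
  by have := congr1 (fun u : {poly K} => u.[0]) rhoq; rewrite rq0 !hornerE => /esym.
have b1 : b 1 = 0.
  by have := congr1 (fun u : {poly K} => u.[1]) rhoq; rewrite rq0 b0 !hornerE => /esym.
move=> j; case: (unliftP 0 j) => [j' ->|-> //].
by rewrite -b1; congr b; apply/val_inj; case: j' => [[]].
Qed.
End Secant.

(** * The secant variety and the rank of the syzygy matrix *)

(** The equations on z obtained by contracting the linear syzygies with y. *)
Definition syzygy_matrix (K : fieldType) n s m (B : 'I_m -> 'M[K]_(s, n.+1))
    (y : 'rV[K]_s) : 'M[K]_(m, n.+1) :=
  \matrix_(k, j) (y *m B k) 0 j.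

Lemma kernel_syzygy_matrix (K : fieldType) n s m
    (B : 'I_m -> 'M[K]_(s, n.+1)) y (z : 'rV_n.+1) :
  z *m (syzygy_matrix B y)^T = 0 <-> forall k, y *m B k *m z^T = 0.
Proof.
have zE k : (z *m (syzygy_matrix B y)^T) 0 k = (y *m B k *m z^T) 0 0.
  by rewrite mxE [RHS]mxE; apply: eq_bigr => j _; rewrite [RHS]mulrC !mxE.
split=> [z0 k|z0]; apply/rowP => k'.
  by rewrite ord1 -zE z0 !mxE.
by rewrite zE z0 !mxE.
Qed.

Lemma syzygy_matrixZ (K : fieldType) n s m (B : 'I_m -> 'M[K]_(s, n.+1)) c y :
  syzygy_matrix B (c *: y) = c *: syzygy_matrix B y.
Proof.
apply/matrixP => k j; rewrite !mxE mulr_sumr.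
by apply: eq_bigr => i _; rewrite !mxE mulrA.
Qed.

Section SecantRank.
Variables (K : numFieldType) (n s m : nat).
Variables (X : closed_subscheme K n) (F : 'I_s.+1 -> {mpoly K[n.+1]}).
Variable (B : 'I_m -> 'M[K]_(s.+1, n.+1)).
Hypothesis hF : forall i, F i \is 2.-homog.
Hypothesis XF : scheme_defined_by X F.
Hypothesis syzB : forall k (z : 'rV_n.+1), eval_forms F z *m B k *m z^T = 0.
Hypothesis kosB : forall (y : 'rV_s.+1) (z : 'rV_n.+1),
  (forall k, y *m B k *m z^T = 0) ->
  forall i j, y 0 i * (F j).@[z 0] = y 0 j * (F i).@[z 0].

Lemma kernel_at_image (z : 'rV_n.+1) : z *m (syzygy_matrix B (eval_forms F z))^T = 0.
Proof. by apply/kernel_syzygy_matrix. Qed.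

Lemma rank_at_image_le (x : 'rV_n.+1) : x != 0 ->
  (\rank (syzygy_matrix B (eval_forms F x)) <= n)%N.
Proof.
move=> x0; rewrite -ltnS ltn_neqAle rank_leq_col andbT.
rewrite -mxrank_tr; apply: contra x0 => /eqP rk.
have fr : row_free (syzygy_matrix B (eval_forms F x))^T by apply/eqP.
by apply/eqP/(row_free_inj fr); rewrite kernel_at_image mul0mx.
Qed.

Lemma mem_scheme i : X (F i).
Proof.
apply/XF; exists 0%N => j; exists (fun l => (l == i)%:R).
rewrite expr0 mul1r (bigD1 i) //= eqxx mul1r big1 ?addr0 // => l /negPf ->.
by rewrite mul0r.
Qed.

(** Up to the factor by which F(z) and F(x) differ, the equations L(F(x)) z = 0
    are the syzygies evaluated at z. *)
Lemma kernel_of_proportional (x z : 'rV_n.+1) j :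
  (F j).@[z 0] != 0 ->
  (forall i, (F j).@[x 0] * (F i).@[z 0] = (F i).@[x 0] * (F j).@[z 0]) ->
  z *m (syzygy_matrix B (eval_forms F x))^T = 0.
Proof.
move=> zj prop; apply/kernel_syzygy_matrix => k.
have -> : eval_forms F x = ((F j).@[x 0] / (F j).@[z 0]) *: eval_forms F z.
  by apply/rowP => i; rewrite !mxE mulrAC prop mulfK.
by rewrite -!scalemxAl syzB scaler0.
Qed.

(** From left to right, [vanish_on_secant_line] makes F proportional to F(x)
    along a secant line, and the syzygies put a second point of this line into
    the kernel. From right to left, a second point of the kernel spans with x a
    line along which F is proportional to F(x), because of the Koszul
    syzygies. *)
Lemma SecE (x : 'rV_n.+1) : x != 0 -> eval_forms F x != 0 ->
  Sec X x <-> \rank (syzygy_matrix B (eval_forms F x)) != n.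
Proof.
move=> x0 /rV0Pn[j]; rewrite mxE => yj; set L := syzygy_matrix _ _.
have xL : x *m L^T = 0 := kernel_at_image x.
split=> [[A [rA xA len]]|rk].
  have [i [k [w fr]]] := adapted_frame_of_line rA xA x0.
  have [xi wi wk frP] := fr.
  have prop l (z : 'rV_n.+1) : (z <= A)%MS ->
      (F j).@[x 0] * (F l).@[z 0] = (F l).@[x 0] * (F j).@[z 0].
    pose g := (F j).@[x 0] *: F l - (F l).@[x 0] *: F j.
    move=> zA; apply/eqP; rewrite -subr_eq0 -!mevalZ -mevalB -/g; apply/eqP.
    apply: (@vanish_on_secant_line _ _ X _ _ _ _ _ fr (F j) g) zA => //.
    - exact: mem_scheme.
    - have idX := ideal_ofP X; have [X0 XD XM] := idX.
      by rewrite /g -scaleNr; apply: XD; apply: idealZ => //; apply: mem_scheme.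
    - by rewrite rpredB ?dhomogZ.
    by rewrite mevalB !mevalZ mulrC subrr.
  have [c FE] := quadric_on_line x w (hF j).
  have [t t0 Ft] : exists2 t, t != 0 & (F j).@[(x + t *: w) 0] != 0.
    (* A quadratic polynomial with nonzero constant term does not vanish at all
       of 1, -1 and 2. *)
    have val t : (F j).@[(x + t *: w) 0] =
        (F j).@[x 0] + c * t + (F j).@[w 0] * t ^+ 2.
      by have := FE 1 t; rewrite scale1r => ->; ring.
    have [e1|n1] := eqVneq (F j).@[(x + 1 *: w) 0] 0; last by exists 1; rewrite ?oner_eq0.
    have [e2|n2] := eqVneq (F j).@[(x + (-1) *: w) 0] 0.
      exists 2; rewrite ?pnatr_eq0 //; apply: contra_neq yj => e3.
      have -> : (F j).@[x 0] = (F j).@[(x + 1 *: w) 0] + 3^-1 *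
          ((F j).@[(x + (-1) *: w) 0] - (F j).@[(x + 2 *: w) 0]).
        by rewrite !val; field.
      by rewrite e1 e2 e3 subrr mulr0 addr0.
    by exists (-1); rewrite ?oppr_eq0 ?oner_eq0.
  have onA : ((x + t *: w)%R <= A)%MS by apply/frP; exists 1, t; rewrite scale1r.
  have := kernel_of_proportional Ft (fun l => prop l _ onA).
  rewrite mulmxDl xL add0r -scalemxAl => /eqP; rewrite scaler_eq0 (negPf t0) /=.
  move=> /eqP wL; apply/eqP => rk.
  have /sub_rVP[a wE] := kernel_corank1 rk x0 xL wL.
  move: wi wk; rewrite wE !mxE => /eqP; rewrite mulf_eq0 (negPf xi) orbF => /eqP ->.
  by rewrite mul0r eqxx.
have /row_subPn[l lx] : ~~ (kermx L^T <= x)%MS.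
  apply/negP => /mxrankS; rewrite mxrank_ker mxrank_tr rank_rV x0.
  rewrite leq_subLR addn1 ltnS => le_n.
  by move: rk; rewrite eqn_leq le_n rank_at_image_le.
set v := row l _ in lx.
have vL : v *m L^T = 0 by apply/sub_kermxP; rewrite row_sub.
have [i [k [w [fr [c wE]]]]] := adapted_frame_col_mx x0 lx.
have [xi wi wk frP] := fr.
have wL : w *m L^T = 0 by rewrite wE mulmxBl -scalemxAl xL vL scaler0 subrr.
exists (col_mx x v); split.
- exact: rank_col_mx2.
- by apply/frP; exists 1, 0; rewrite scale1r scale0r addr0.
apply: (@length_ge2_of_proportional _ _ _ _ F _ _ _ _ _ (F j)
  (fun i => (F i).@[x 0] / (F j).@[x 0]) fr) => //.
move=> l' z /frP[a [b ->]].
set z' := a *: x + b *: w.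
have /kosB : forall k, eval_forms F x *m B k *m z'^T = 0.
  by apply/kernel_syzygy_matrix; rewrite mulmxDl -!scalemxAl xL wL !scaler0 addr0.
by move=> /(_ l' j); rewrite !mxE mulrAC => ->; rewrite mulrAC mulfV // mul1r.
Qed.

End SecantRank.

(** * The embedding *)

Section FormMatrix.
Variables (K : fieldType) (n s m r : nat) (B : 'I_m -> 'M[K]_(s, n.+1)).
Variable Y : 'I_s -> {mpoly K[r]}.

(** The matrix L(Y) for a vector Y of forms: generic coordinates of the target
    for the equations of the image, and F itself for those of the domain. *)
Definition syzygy_form_matrix : 'M[{mpoly K[r]}]_(m, n.+1) :=
  \matrix_(k, j) \sum_i B k i j *: Y i.

Lemma eval_syzygy_form_matrix v : map_mx (meval v) syzygy_form_matrix =
  syzygy_matrix B (\row_i (Y i).@[v]).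
Proof.
apply/matrixP => k j; rewrite !mxE rmorph_sum; apply: eq_bigr => i _.
by rewrite /= mevalZ mxE mulrC.
Qed.

Definition cross_form (t : 'I_n -> 'I_m) (j : 'I_n.+1) : {mpoly K[r]} :=
  cross (rowsub t syzygy_form_matrix) 0 j.

Lemma eval_cross_form t j v : (cross_form t j).@[v] =
  cross (rowsub t (syzygy_matrix B (\row_i (Y i).@[v]))) 0 j.
Proof.
rewrite -eval_syzygy_form_matrix -map_mxsub -map_cross mxE //.
Qed.

Lemma homog_syzygy_form_matrix e k j : (forall i, Y i \is e.-homog) ->
  syzygy_form_matrix k j \is e.-homog.
Proof. by move=> hY; rewrite mxE rpred_sum // => i _; apply: dhomogZ. Qed.

Lemma homog_cross_form e t j : (forall i, Y i \is e.-homog) ->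
  cross_form t j \is (e * n).-homog.
Proof.
by move=> hY; apply: homog_cross => a b; rewrite mxE homog_syzygy_form_matrix.
Qed.
End FormMatrix.

Lemma sub_rowP (K : fieldType) n (y v : 'rV[K]_n) : y != 0 -> (y <= v)%MS ->
  exists2 a, a != 0 & y = a *: v.
Proof.
move=> y0 /sub_rVP[a yE]; exists a => //.
by apply: contraNneq y0 => a0; rewrite yE a0 scale0r.
Qed.

Lemma vars_at (K : fieldType) n (y : 'rV[K]_n) :
  \row_i ('X_i : {mpoly K[n]}).@[y 0] = y.
Proof. by apply/rowP => i; rewrite mxE mevalXU. Qed.

Section Embedding.
Variables (K : numFieldType) (n s m : nat).
Variables (X : closed_subscheme K n) (F : 'I_s.+1 -> {mpoly K[n.+1]}).
Variable (B : 'I_m -> 'M[K]_(s.+1, n.+1)).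
Hypothesis hF : forall i, F i \is 2.-homog.
Hypothesis XF : scheme_defined_by X F.
Hypothesis syzB : forall k (z : 'rV_n.+1), eval_forms F z *m B k *m z^T = 0.
Hypothesis kosB : forall (y : 'rV_s.+1) (z : 'rV_n.+1),
  (forall k, y *m B k *m z^T = 0) ->
  forall i j, y 0 i * (F j).@[z 0] = y 0 j * (F i).@[z 0].

Let U (x : 'rV[K]_n.+1) := eval_forms F x != 0 /\ ~ Sec X x.
Let L := syzygy_matrix B.

Lemma domainE x : x != 0 ->
  U x <-> eval_forms F x != 0 /\ \rank (L (eval_forms F x)) = n.
Proof.
move=> x0; have sec := SecE hF XF syzB kosB x0.
split=> -[y0 h]; split=> //; have := sec y0.
  by case: eqP => // _ [_ /(_ isT)].
by rewrite -/(L _) h eqxx => -[+ _] => /[apply].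
Qed.

Lemma eval_formsZ c x : eval_forms F (c *: x) = c ^+ 2 *: eval_forms F x.
Proof.
apply/rowP => i; rewrite !mxE -(meval_scale c (x 0) (hF i)).
by apply: meval_eq => j; rewrite mxE.
Qed.

Lemma eval_forms_neq0 x : eval_forms F x != 0 -> x != 0.
Proof. by apply: contraNneq => ->; rewrite -(scale0r 0) eval_formsZ expr0n scale0r. Qed.

Lemma domain_locally_closed : locally_closed U.
Proof.
pose S2 p := exists i (t : 'I_n -> 'I_m) j, p = F i * cross_form B F t j.
exists (fun => True), (fun x => forall p, S2 p -> p.@[x 0] = 0); split.
- by exists (fun => False); split=> // x _; split.
- exists S2; split=> // p [i [t [j ->]]]; exists (2 + 2 * n)%N.
  by rewrite dhomogM ?homog_cross_form.
move=> x x0; rewrite (domainE x0); split=> [[/rV0Pn[i Fi] rk]|[_ nZ]].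
  split=> // Z; have [t /rV0Pn[j]] := exists_cross rk.
  have := Z _ (ex_intro _ i (ex_intro _ (t : _ -> _) (ex_intro _ j erefl))).
  move/eqP; rewrite mevalM eval_cross_form mulf_eq0 => /orP[].
    by move: Fi; rewrite mxE => /negPf ->.
  by move=> /eqP e; rewrite e eqxx.
have [F0|F0] := eqVneq (eval_forms F x) 0.
  case: nZ => _ [i [t [j ->]]]; have := congr1 (fun v : 'rV__ => v 0 i) F0.
  by rewrite mevalM !mxE => ->; rewrite mul0r.
split=> //; apply/eqP; rewrite eqn_leq rank_at_image_le //= leqNgt.
apply/negP => lt; apply: nZ => _ [i [t [j ->]]]; rewrite mevalM eval_cross_form.
have [->|nz] := eqVneq (cross (rowsub t (L (eval_forms F x)))) 0.
  by rewrite mxE mulr0.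
by have := rank_cross nz; rewrite leqNgt lt.
Qed.

Lemma domain_regular : regular_on U (eval_forms F).
Proof.
move=> x _ _; exists 2, 0%N, F, 1; split=> //; first exact: dhomog1.
  by rewrite meval1 oner_eq0.
by move=> x' _ [Fx' _] _; rewrite Fx' submx_refl.
Qed.

Lemma image_kernel y : y != 0 -> image_pts U (eval_forms F) y ->
  exists x a, [/\ U x, a != 0, y = a *: eval_forms F x,
    x *m (L y)^T = 0 & \rank (L y) = n].
Proof.
move=> y0 [x [x0 Ux /andP[/(sub_rowP y0)[a a0 yE] _]]]; exists x, a.
have [_ rk] := (domainE x0).1 Ux.
split=> //; rewrite /L yE syzygy_matrixZ ?mxrank_scale_nz //.
by rewrite linearZ -scalemxAr kernel_at_image ?scaler0.
Qed.

(** For y in the image, [cross] of the rows t of L(y) lies in the kernel, which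
    is spanned by a preimage of y. Conversely, if it lies in the kernel and F
    does not vanish there, then it is a preimage by the Koszul syzygies, and
    the corank is 1 because the minors at t are not all zero. *)
Lemma image_locally_closed : locally_closed (image_pts U (eval_forms F)).
Proof.
pose Y (i : 'I_s.+1) : {mpoly K[s.+1]} := 'X_i.
have hY i : Y i \is 1.-homog by rewrite dhomogX /= mdeg1.
pose S1 p := exists (t : 'I_n -> 'I_m) k,
  p = \sum_j cross_form B Y t j * syzygy_form_matrix B Y k j.
pose S2 p := exists (t : {ffun 'I_n -> 'I_m}) i,
  p = F i \mPo [tuple cross_form B Y t j | j < n.+1].
have S1E t k (y : 'rV_s.+1) :
    (\sum_j cross_form B Y t j * syzygy_form_matrix B Y k j).@[y 0] =
    (cross (rowsub t (L y)) *m (L y)^T) 0 k.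
  rewrite rmorph_sum mxE; apply: eq_bigr => j _.
  rewrite rmorphM /= eval_cross_form vars_at; congr (_ * _).
  have := congr1 (fun M : 'M_(m, n.+1) => M k j) (eval_syzygy_form_matrix B Y (y 0)).
  by rewrite mxE vars_at => ->; rewrite [RHS]mxE.
have S2E (t : {ffun 'I_n -> 'I_m}) i (y : 'rV_s.+1) :
    (F i \mPo [tuple cross_form B Y t j | j < n.+1]).@[y 0] =
    (F i).@[cross (rowsub t (L y)) 0].
  rewrite comp_mpoly_meval; apply: meval_eq => j.
  by rewrite tnth_mktuple eval_cross_form vars_at.
exists (fun y => forall p, S1 p -> p.@[y 0] = 0),
       (fun y => forall p, S2 p -> p.@[y 0] = 0); split.
- exists S1; split=> // p [t [k ->]]; exists (1 * n + 1)%N.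
  apply: rpred_sum => j _; apply: dhomogM; first exact: homog_cross_form.
  exact: homog_syzygy_form_matrix.
- exists S2; split=> // p [t [i ->]]; exists (2 * (1 * n))%N.
  by apply: homog_comp => // j; rewrite tnth_mktuple homog_cross_form.
move=> y y0; split=> [/(image_kernel y0)[x [a [Ux a0 yE xL rk]]]|[Z1 nZ2]].
  have x0 := eval_forms_neq0 Ux.1.
  split=> [_ [t [k ->]]|Z2].
    by rewrite S1E (cross_in_kernel _ x0 xL) mxE.
  have [t nz] := exists_cross rk.
  have [b b0 xE] := sub_rowP x0 (kernel_sub_cross nz xL).
  have [/eqP + _] := Ux; apply; rewrite xE eval_formsZ.
  apply/rowP => i; rewrite mxE [in X in _ * X]mxE -S2E Z2 ?mulr0 ?mxE //.
  by exists t, i.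
have /existsP[t /existsP[i Fi]] : [exists t : {ffun 'I_n -> 'I_m},
    exists i, (F i).@[cross (rowsub t (L y)) 0] != 0].
  apply: contraT => /existsPn h; case: nZ2 => _ [t [i ->]].
  by have /existsPn/(_ i)/negPn/eqP := h t; rewrite S2E.
set x := cross _ in Fi.
have xL : x *m (L y)^T = 0.
  by apply/rowP => k; rewrite -S1E Z1 ?mxE //; exists t, k.
have Fx0 : eval_forms F x != 0 by apply/rV0Pn; exists i; rewrite mxE.
have x0 := eval_forms_neq0 Fx0.
have kos := kosB ((kernel_syzygy_matrix _ _ _).1 xL).
have /rV0Pn[l yl] := y0.
have FxE : eval_forms F x = ((F l).@[x 0] / y 0 l) *: y.
  by apply/rowP => l'; rewrite !mxE mulrAC [_ * y 0 l']mulrC -kos mulrAC mulfV // mul1r.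
have c0 : (F l).@[x 0] / y 0 l != 0.
  by apply: contraNneq Fx0 => c0; rewrite FxE c0 scale0r.
exists x; split=> //; last first.
  by rewrite FxE; apply/andP; split; [rewrite eqmx_scale | apply: scalemx_sub].
apply/domainE => //; split=> //; apply/eqP.
rewrite eqn_leq rank_at_image_le // {1}FxE /L syzygy_matrixZ mxrank_scale_nz //.
exact: rank_cross x0.
Qed.

Definition inverse_map (y : 'rV[K]_s.+1) : 'rV[K]_n.+1 := nz_row (kermx (L y)^T).

Lemma inverse_map_kernel y (x : 'rV_n.+1) : \rank (L y) = n -> x != 0 ->
  x *m (L y)^T = 0 -> (inverse_map y == x)%MS.
Proof.
move=> rk x0 xL.
have gL : inverse_map y *m (L y)^T = 0 by apply/sub_kermxP; rewrite nz_row_sub.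
have g0 : inverse_map y != 0.
  rewrite nz_row_eq0; apply: contraNneq x0 => k0.
  by move/sub_kermxP: xL; rewrite k0 submx0.
by rewrite !(kernel_corank1 rk _ _ _).
Qed.

(** Near a given point of the image, the maximal minors of a fixed selection of
    rows span the kernel and give the inverse map by forms. *)
Lemma inverse_regular : regular_on (image_pts U (eval_forms F)) inverse_map.
Proof.
move=> y y0 /(image_kernel y0)[x [a [Ux a0 yE xL rk]]].
pose Y (i : 'I_s.+1) : {mpoly K[s.+1]} := 'X_i.
have hY i : Y i \is 1.-homog by rewrite dhomogX /= mdeg1.
have [t /rV0Pn[j nz]] := exists_cross rk.
have cE (z : 'rV_s.+1) : eval_forms (cross_form B Y t) z = cross (rowsub t (L z)).
  by apply/rowP => k; rewrite mxE eval_cross_form vars_at.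
exists (1 * n)%N, (1 * n)%N, (cross_form B Y t), (cross_form B Y t j); split.
- by move=> k; apply: homog_cross_form.
- exact: homog_cross_form.
- by rewrite eval_cross_form vars_at.
move=> z z0 /(image_kernel z0)[x' [a' [Ux' _ _ x'L rk']]] cz.
have x'0 := eval_forms_neq0 Ux'.1.
have c0 : cross (rowsub t (L z)) != 0.
  by apply/rV0Pn; exists j; rewrite -cE mxE.
rewrite cE; split=> //.
have := inverse_map_kernel rk' c0 (cross_in_kernel _ x'0 x'L).
by rewrite andbC.
Qed.

Lemma embedding_off_Sec : embedding_off (Sec X) F.
Proof.
split; [exact: domain_locally_closed|exact: domain_regular|
  exact: image_locally_closed|exists inverse_map; split; first exact: inverse_regular].
move=> x x0 /(domainE x0)[_ rk].
by apply: inverse_map_kernel => //; apply: kernel_at_image.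
Qed.
End Embedding.

Local Open Scope complex_scope.

Theorem corollary2p5 (R : realType) (n s : nat)
    (X : closed_subscheme R[i] n) (F : 'I_s.+1 -> {mpoly R[i][n.+1]}) :
  condition_K F 2 ->
  scheme_defined_by X F ->
  embedding_off (Sec X) F.
Proof.
move=> kF XF; have [m [B [syzB kosB]]] := koszul_linear_matrices kF.
exact: (@embedding_off_Sec R[i] n s m X F B kF.1 XF syzB kosB).
Qed.
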